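(* Let $g_t\in\mathbb R^{n_2}$ and consider the segment $g(s):=g_t-s\lambda_t\nabla\mathcal J(g_t)$, $s\in[0,1]$, with step size $$\lambda_t:=\frac1{L(g_t)},\qquad L(g_t):=\frac C\varepsilon\|\nabla\mathcal J_{\mathrm{trans}}(g_t)\|_\infty+\frac{C\beta_{\max}}{\rho_2}+\frac{C}{e\,\varepsilon}\|\nabla\mathcal J(g_t)\|_\infty,$$ where $C=6e$ for the $\chi^2$ source and $C=(2+3\alpha)e$ for the KL source. Then for any two points $g_1,g_2$ on the segment $\{g(s):s\in[0,1]\}$, $$\|\nabla\mathcal J(g_1)-\nabla\mathcal J(g_2)\|\le L(g_t)\,\|g_1-g_2\|.$$
   Context: $\mathcal X,\mathcal Y$ are Polish spaces; $\mu=\sum_{i=1}^{n_1}\alpha_i\delta_{x_i}$ and $\nu=\sum_{j=1}^{n_2}\beta_j\delta_{y_j}$ are discrete positive measures on $\mathcal X$ and $\mathcal Y$, with $b/n_2\le\beta_j\le B/n_2$ for constants $0<b\le B$, and $\beta_{\max}=\max_j\beta_j$. The cost $c:\mathcal X\times\mathcal Y\to[0,\infty)$ is continuous, $\varepsilon,\rho_1,\rho_2>0$, and $\alpha=\frac{\varepsilon}{\varepsilon+\rho_1}$ (not to be confused with the weights $\alpha_i$); $e$ is Euler's number and $\|\cdot\|$ the Euclidean norm. For $x\in\mathcal X$, $\mathbf g\in\mathbb R^{n_2}$: $B_j(x,\mathbf g)=\beta_j\exp\big(\tfrac{g_j-c(x,y_j)}{\varepsilon}\big)$ and $Z(x,\mathbf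 g)=\sum_jB_j(x,\mathbf g)$. The semi-dual objective of entropic unbalanced optimal transport (with $\chi^2$ target penalty) is $$\mathcal J(\mathbf g)=\mathcal J_{\mathrm{trans}}(\mathbf g)+\sum_{j=1}^{n_2}\beta_j\Big(\frac{g_j^2}{2\rho_2}-g_j\Big),$$ where: - KL source: $\mathcal J_{\mathrm{trans}}(\mathbf g)=(\rho_1+\varepsilon)\int_{\mathcal X}Z(x,\mathbf g)^\alpha d\mu(x)$; - $\chi^2$ source: $\mathcal J_{\mathrm{trans}}(\mathbf g)=\frac{\varepsilon^2}{\rho_1}\int_{\mathcal X}\big(W(U(x,\mathbf g))+\tfrac12W(U(x,\mathbf g))^2\big)d\mu(x)$, with $U(x,\mathbf g)=\frac{\rho_1}{\varepsilon}e^{\rho_1/\varepsilon}Z(x,\mathbf g)$ and $W$ the Lambert function (inverse of $z\mapsto ze^z$ on $[0,\infty)$). *)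

(* Defs.v *)
From mathcomp Require Import all_boot all_order all_algebra.
From mathcomp Require Import all_classical all_reals all_analysis.

Set Implicit Arguments.
Unset Strict Implicit.
Unset Printing Implicit Defensive.

Import Order.TTheory GRing.Theory Num.Theory.
Import numFieldNormedType.Exports.

Local Open Scope classical_set_scope.
Local Open Scope ring_scope.

(** A topological space is Polish when it is separable and its topology is
    induced by some complete metric [d]; no particular metric is fixed. *)
Definition polish_space (R : realType) (T : topologicalType) : Prop :=
  (exists2 S : set T, countable S & dense S) /\
  exists d : T -> T -> R,
    [/\ (forall x y, 0 <= d x y) /\ (forall x y, d x y = 0 <-> x = y),
        forall x y, d x y = d y x,
        forall x y z, d x z <= d x y + d y z,
        forall x (A : set T),
          nbhs x A <-> exists2 e, 0 < e & [set y | d x y < e] `<=` A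
      & forall u : nat -> T,
          (forall e, 0 < e -> exists N, forall m n,
             (N <= m)%N -> (N <= n)%N -> d (u m) (u n) < e) ->
          exists l : T, u @ \oo --> l].

Notation borel T := (g_sigma_algebraType (@open T)).

Definition is_discrete_measure (R : realType) (T : ptopologicalType) (n : nat)
    (mu : set (borel T) -> \bar R) (w : 'I_n -> R) (p : 'I_n -> T) : Prop :=
  forall A : set (borel T), measurable A ->
    mu A = (\sum_(i < n) (w i)%:E * \d_(p i : borel T) A)%E.

(** The library norm [`|v|] on ['rV[R]_n] is the sup norm, hence a separate
    Euclidean norm. *)
Definition enorm (R : realType) (n : nat) (v : 'rV[R]_n) : R :=
  Num.sqrt (\sum_(j < n) v 0 j ^+ 2).

Definition gradient (R : realType) (n : nat) (f : 'rV[R]_n -> R)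
    (g : 'rV[R]_n) : 'rV[R]_n :=
  \row_(j < n) 'D_(delta_mx 0 j : 'rV[R]_n) f g.

(** Inverse of [z |-> z * exp z] on the nonnegative half-line; the value at a
    negative argument is unspecified. *)
Definition lambertW (R : realType) (u : R) : R :=
  get [set w | 0 <= w /\ w * expR w = u].

Variant source := KL | Chi2.

Section semidual.
Context {R : realType} {X Y : ptopologicalType} {n2 : nat}.
Variables (src : source) (mu : {measure set (borel X) -> \bar R}).
Variables (c : X * Y -> R) (beta : 'I_n2 -> R) (y : 'I_n2 -> Y).
Variables (eps rho1 rho2 : R).
Implicit Type g : 'rV[R]_n2.

Definition ot_alpha : R := eps / (eps + rho1).

Definition ot_B (x : X) g (j : 'I_n2) : R :=
  beta j * expR ((g 0 j - c (x, y j)) / eps).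

Definition ot_Z (x : X) g : R := \sum_(j < n2) ot_B x g j.

Definition ot_U (x : X) g : R :=
  rho1 / eps * expR (rho1 / eps) * ot_Z x g.

Definition J_trans g : R :=
  match src with
  | KL => (rho1 + eps) * \int[mu]_x (ot_Z x g `^ ot_alpha)
  | Chi2 => eps ^+ 2 / rho1 *
      \int[mu]_x (lambertW (ot_U x g) + 2^-1 * lambertW (ot_U x g) ^+ 2)
  end.

Definition J_semidual g : R :=
  J_trans g + \sum_(j < n2) beta j * (g 0 j ^+ 2 / (2 * rho2) - g 0 j).

Definition beta_max : R := \big[Num.max/0]_(j < n2) beta j.

Definition smooth_const : R :=
  match src with
  | KL => (2 + 3 * ot_alpha) * expR 1
  | Chi2 => 6 * expR 1
  end.

(** [`|_|] is the sup norm here. *)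
Definition smooth_L g : R :=
  smooth_const / eps * `|gradient J_trans g|
  + smooth_const * beta_max / rho2
  + smooth_const / (expR 1 * eps) * `|gradient J_semidual g|.

Definition step_size g : R := 1 / smooth_L g.

Definition grad_step g (s : R) : 'rV[R]_n2 :=
  g - (s * step_size g) *: gradient J_semidual g.

Definition grad_segment g : set 'rV[R]_n2 := grad_step g @` `[0, 1].

End semidual.

(* Main.v *)
Require Import Defs.
From mathcomp Require Import all_boot all_order all_algebra.
From mathcomp Require Import all_classical all_reals all_analysis.
From mathcomp Require Import measurable_realfun.
From mathcomp Require Import ring lra.

(** Both sources have the same shape. Once the integral against the discrete
    measure is written as a finite sum, the transport part is
    [sum_i a_i * phi (Z (x_i, g))], where [psi = phi'] is nonnegative and
    [psi' (z) = - th (z) * psi (z) / z] for some [th] with values in [0, 1]: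
    [psi] decreases, but never faster than [1 / z] ([tame_profile]). For the KL
    source [phi] is a power of exponent [alpha] and [th = 1 - alpha]; for the
    chi-square source [psi] is proportional to [exp (- W)] and
    [th = W / (1 + W)].

    Differentiating twice, the Hessian of the transport part is
    [sum_i a_i psi(Z_i) / eps^2 (diag B_i - th(Z_i) / Z_i * B_i B_i^T)].
    As [0 <= th <= 1] and [B_i B_i^T <= Z_i diag B_i] by Cauchy-Schwarz, it lies
    between [0] and the diagonal matrix of the gradient divided by [eps]. The
    penalty adds [diag (beta / rho2)]; so at every point the Hessian of the
    objective lies between [0] and [M = max_j (dJtrans_j / eps + beta_j / rho2)]
    ([hess_bounds]). Where such an [M] is uniform along a segment, the mean value
    theorem makes the gradient [M]-Lipschitz there ([semidual_grad_lipschitz]).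

    It remains to compare the gradient along the descent segment with the one at
    its origin. Since [2 * e <= C], a step of size [1 / L] moves no coordinate by
    more than [eps / 2]. A displacement of at most [t * eps] multiplies each [B_j]
    and each [psi (Z)] by at most [exp t], hence the transport gradient by at most
    [exp (2 * t)] ([trans_grad_harnack]). For
    [t = 1 / 2] this factor is [e], which is at most [C], and [M <= L]
    follows ([segment_lipschitz]). *)

Import Order.TTheory GRing.Theory Num.Theory.
Import numFieldNormedType.Exports.
Local Open Scope classical_set_scope.
Local Open Scope ring_scope.

Set Implicit Arguments.
Unset Strict Implicit.
Unset Printing Implicit Defensive.

(** * Derivatives along lines *)

Section lines.
Variables (R : realType) (n : nat).
Implicit Types (u v w g : 'rV[R]_n).

Lemma is_derive_bigsum k (h : 'I_k -> R -> R) (s : R) (dh : 'I_k -> R) :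
  (forall i, is_derive s 1 (h i) (dh i)) ->
  is_derive s 1 (fun t => \sum_(i < k) h i t) (\sum_(i < k) dh i).
Proof.
move=> dhP; have := is_derive_sum dhP.
by congr is_derive; apply/funext => t; rewrite fct_sumE.
Qed.

(** The difference quotient behind [derive] is that of a function of one real
    variable, so the gradient comes from one-variable calculus, without
    differentiability in several variables. *)
Lemma derive_line (f : 'rV[R]_n -> R) g v (d : R) :
  is_derive (0 : R) (1 : R) (fun s : R => f (g + s *: v)) d -> 'D_v f g = d.
Proof.
move=> [_ <-]; rewrite /derive; set q := fun h => _; set r := (fun h => _ in RHS).
suff -> : q = r by [].
apply/funext => h; rewrite /q /r /=.
by rewrite addr0 scale0r addr0 [h%:A]mulr1 (addrC g).
Qed.

Lemma coord_le_norm g j : `|g 0 j| <= `|g|.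
Proof.
rewrite /Num.Def.normr /= mx_normrE.
exact: (le_bigmax _ (fun ij : 'I_1 * 'I_n => `|g ij.1 ij.2|) (0, j)).
Qed.

End lines.

(** * Weighted linear and diagonal forms *)

Section weighted_forms.
Variables (R : realType) (n : nat).
Implicit Types (d : 'I_n -> R) (u v w : 'rV[R]_n).

Definition lin_form d v : R := \sum_(j < n) d j * v 0 j.
Definition diag_form d u v : R := \sum_(j < n) d j * (u 0 j * v 0 j).

Lemma lin_form_line d u v (t : R) :
  lin_form d (u + t *: v) = lin_form d u + t * lin_form d v.
Proof.
rewrite /lin_form mulr_sumr -big_split /=; apply: eq_bigr => j _.
by rewrite !mxE; ring.
Qed.

Lemma diag_form_line d u v (t : R) :
  diag_form d (u + t *: v) (u + t *: v) =
  diag_form d u u + 2 * t * diag_form d u v + t ^+ 2 * diag_form d v v.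
Proof.
rewrite /diag_form !mulr_sumr -!big_split /=; apply: eq_bigr => j _.
by rewrite !mxE; ring.
Qed.

Lemma diag_form_le d w (M : R) : (forall j, d j <= M) ->
  diag_form d w w <= M * enorm w ^+ 2.
Proof.
move=> dM; rewrite /enorm sqr_sqrtr ?sumr_ge0// => [|j _]; last exact: sqr_ge0.
rewrite mulr_sumr; apply: ler_sum => j _; rewrite -expr2.
by rewrite ler_wpM2r ?sqr_ge0.
Qed.

Lemma diag_form_ge0 d w : (forall j, 0 <= d j) -> 0 <= diag_form d w w.
Proof.
by move=> d0; apply: sumr_ge0 => j _; rewrite mulr_ge0// -expr2 sqr_ge0.
Qed.

(** Cauchy-Schwarz for the weights [d], from the nonnegativity of the weighted
    variance of the coordinates of [w]. *)
Lemma lin_form_sqr_le d w : 0 < \sum_(j < n) d j -> (forall j, 0 <= d j) ->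
  lin_form d w ^+ 2 <= (\sum_(j < n) d j) * diag_form d w w.
Proof.
move=> Z0 d0; set Z := \sum_(j < n) d j; set l := lin_form d w.
have : 0 <= \sum_(j < n) d j * (Z * w 0 j - l) ^+ 2.
  by apply: sumr_ge0 => j _; rewrite mulr_ge0// sqr_ge0.
rewrite (_ : \sum_(j < n) _ = Z * (Z * diag_form d w w - l ^+ 2)).
  by rewrite pmulr_rge0// subr_ge0.
rewrite (eq_bigr (fun j => Z ^+ 2 * (d j * (w 0 j * w 0 j)) -
  2 * Z * l * (d j * w 0 j) + l ^+ 2 * d j)) => [|j _]; last by ring.
rewrite big_split sumrB /= -!mulr_sumr -/(lin_form d w) -/(diag_form d w w).
by rewrite -/l -/Z; ring.
Qed.

(** The first hypothesis is what is left of symmetric bilinearity on the line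
    through [u] directed by [v]. Polarization between [u + M v] and [u - M v]
    turns bounds on the quadratic form into one on [H u v]; the right-hand side
    is shaped so that [H u v = enorm u ^+ 2] yields [enorm u <= M * enorm v]. *)
Lemma form_le (H : 'rV[R]_n -> 'rV[R]_n -> R) (M : R) u v :
  0 < M ->
  (forall t : R, H (u + t *: v) (u + t *: v) =
     H u u + 2 * t * H u v + t ^+ 2 * H v v) ->
  (forall w, 0 <= H w w <= M * enorm w ^+ 2) ->
  2 * H u v <= enorm u ^+ 2 + M ^+ 2 * enorm v ^+ 2.
Proof.
move=> M0 HE H01.
have /andP[_ Hp] := H01 (u + M *: v); have /andP[Hm _] := H01 (u + (- M) *: v).
have norm_sum : enorm (u + M *: v) ^+ 2 <= 2 * (enorm u ^+ 2 + M ^+ 2 * enorm v ^+ 2).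
  rewrite /enorm !sqr_sqrtr ?sumr_ge0//; try by move=> j _; exact: sqr_ge0.
  rewrite mulr_sumr -big_split mulr_sumr /=; apply: ler_sum => j _.
  rewrite !mxE; have := sqr_ge0 (u 0 j - M * v 0 j); nra.
rewrite HE in Hp; rewrite HE in Hm.
have {}norm_sum := ler_wpM2l (ltW M0) norm_sum.
by rewrite -(ler_pM2l M0); lra.
Qed.

End weighted_forms.

(** * Profiles that decrease no faster than the inverse function *)

Section profiles.
Variable R : realType.
Implicit Types (phi psi th f : R -> R) (z t u w : R).

(** [th z] is minus the logarithmic derivative of [psi] with respect to [ln z],
    the quantity that the Hessian bounds and the Harnack inequality share. *)
Definition tame_profile phi psi th := forall z, 0 < z ->
  [/\ 0 <= psi z, 0 <= th z <= 1, is_derive z 1 phi (psi z)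
    & is_derive z 1 psi (- (th z * psi z / z))].

Lemma pos_nondecreasing f (df : R -> R) :
  (forall z, 0 < z -> is_derive z 1 f (df z)) ->
  (forall z, 0 < z -> 0 <= df z) ->
  forall a b, 0 < a -> a <= b -> f a <= f b.
Proof.
move=> fP df0 a b a0 ab.
have pos z : z \in `[a, b] -> 0 < z by rewrite in_itv => /andP[/(lt_le_trans a0)].
have [z /subset_itv_oo_cc zab||c /pos c0 fE] := @MVT_segment _ f df a b ab.
- exact/fP/pos.
- apply: continuous_in_subspaceT => y; rewrite inE/= => /pos/fP[fy _].
  exact/differentiable_continuous/derivable1_diffP.
- by rewrite -subr_ge0 fE mulr_ge0 ?subr_ge0 ?df0.
Qed.

(** Since [th >= 0], [psi] is nonincreasing; since [th <= 1], [z * psi z] is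
    nondecreasing. The two monotonicities are used on either side of the point
    [exp (- t) * z0]. *)
Lemma profile_harnack phi psi th z0 z t : tame_profile phi psi th ->
  0 <= t -> 0 < z0 -> expR (- t) * z0 <= z -> psi z <= expR t * psi z0.
Proof.
move=> H t0 z00 zz.
set y := expR (- t) * z0 in zz.
have y0 : 0 < y by rewrite mulr_gt0 ?expR_gt0.
have yz0 : y <= z0 by rewrite ler_piMl ?(ltW z00)// -expR0 ler_expR oppr_le0.
have psi_decr : psi z <= psi y.
  rewrite -lerN2; apply: (@pos_nondecreasing (- psi) (fun x => th x * psi x / x)) => //.
    move=> x /H[_ _ _ D]; rewrite -[_ / x]opprK; exact: is_deriveN.
  by move=> x x0; have [? /andP[? ?] _ _] := H x x0; rewrite !mulr_ge0// invr_ge0 ltW.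
have psi_incr : y * psi y <= z0 * psi z0.
  apply: (@pos_nondecreasing (id * psi) (fun x => (1 - th x) * psi x)) => //.
    move=> x x0; have [_ _ _ D] := H x x0.
    apply: is_derive_eq; rewrite /= [_ *: _]mulrC scaler1/=.
    rewrite /GRing.scale/=; field.
    exact: lt0r_neq0.
  by move=> x x0; have [? /andP[? ?] _ _] := H x x0; rewrite mulr_ge0// subr_ge0.
apply: (le_trans psi_decr); rewrite -(ler_pM2l y0) (le_trans psi_incr)//.
by rewrite /y mulrACA -expRD addNr expR0 mul1r.
Qed.

(** The profile of the KL source. *)
Lemma powR_profile (k al : R) : 0 <= k -> 0 <= al <= 1 ->
  tame_profile (fun z => k * z `^ al) (fun z => k * al * z `^ (al - 1))
    (fun=> 1 - al).
Proof.
move=> k0 /andP[al0 al1] z z0; split.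
- by rewrite !mulr_ge0// powR_ge0.
- by lra.
- have D := is_derive1_powR al z0.
  apply: is_derive_eq (is_deriveZ k D) _.
  by rewrite /GRing.scale/= mulrA.
- have D := is_derive1_powR (al - 1) z0.
  apply: is_derive_eq (is_deriveZ (k * al) D) _.
  rewrite /GRing.scale/= powRB ?powRr1 ?ltW// ?(gt_eqF z0) ?implybT//.
  by field; exact: lt0r_neq0.
Qed.

Definition wexp (w : R) : R := w * expR w.

Lemma is_derive_wexp (w : R) : is_derive w 1 wexp ((1 + w) * expR w).
Proof.
by apply: (@is_derive_eq _ _ _ (id * expR)); rewrite /GRing.scale /=; ring.
Qed.

Lemma wexp_mono : {in Num.nneg &, {mono wexp : x y / x <= y}}.
Proof.
apply: le_mono_in => x y; rewrite !nnegrE => x0 y0 xy.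
by rewrite /wexp ltr_pM ?expR_ge0 ?ltr_expR.
Qed.

(** The intermediate value theorem on [0, u] applies because [u <= u * exp u]. *)
Lemma lambertWP u : 0 <= u -> 0 <= lambertW u /\ wexp (lambertW u) = u.
Proof.
move=> u0; apply: (@getPex _ [set w | 0 <= w /\ w * expR w = u]).
have [||w /[!in_itv]/= /andP[w0 _] <-] := @IVT _ wexp 0 u u u0.
- apply: continuous_subspaceT => w.
  have [D _] := is_derive_wexp w; exact/differentiable_continuous/derivable1_diffP.
- rewrite /wexp mul0r min_l ?mulr_ge0 ?expR_ge0// u0 max_r ?mulr_ge0 ?expR_ge0//=.
  by rewrite ler_peMr// -expR0 ler_expR.
by exists w.
Qed.

Lemma wexpK w : 0 <= w -> lambertW (wexp w) = w.
Proof.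
move=> w0; have w1 : 0 <= wexp w by rewrite mulr_ge0 ?expR_ge0.
have [l0] := lambertWP w1.
by apply: (inc_inj_in wexp_mono); rewrite nnegrE.
Qed.

Lemma lambertW_gt0 u : 0 < u -> 0 < lambertW u.
Proof.
move=> u0; have [] := lambertWP (ltW u0); rewrite le_eqVlt => /predU1P[<-|//].
by rewrite /wexp mul0r => uE; rewrite -uE ltxx in u0.
Qed.

Lemma is_derive_lambertW u : 0 < u ->
  is_derive u 1 (@lambertW R) (((1 + lambertW u) * expR (lambertW u))^-1).
Proof.
move=> u0; have w0 := lambertW_gt0 u0; have [_ wE] := lambertWP (ltW u0).
rewrite -{1}wE; apply: (@is_derive_inverse _ wexp).
- near=> w; apply: wexpK; apply: ltW; near: w; exact: lt_nbhsr.
- near=> w; have [D _] := is_derive_wexp w.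
  exact/differentiable_continuous/derivable1_diffP.
- exact: is_derive_wexp.
- by rewrite mulf_neq0// gt_eqF// ?expR_gt0// addr_gt0.
Unshelve. all: by end_near. Qed.

(** The profile of the chi-square source. From [W' = 1 / ((1 + W) * exp W)] the
    derivative of [W + W ^ 2 / 2] is [(1 + W) * W' = exp (- W)]; eliminating the
    outer factor [l] through [l * z = W * exp W] brings the logarithmic derivative
    of [exp (- W)] to the form [- (W / (1 + W)) / z]. *)
Lemma lambertW_profile (k l : R) : 0 <= k -> 0 < l ->
  tame_profile
    (fun z => k * (lambertW (l * z) + 2^-1 * lambertW (l * z) ^+ 2))
    (fun z => k * l * expR (- lambertW (l * z)))
    (fun z => lambertW (l * z) / (1 + lambertW (l * z))).
Proof.
move=> k0 l0 z z0; have lz0 : 0 < l * z by rewrite mulr_gt0.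
have [_ wE] := lambertWP (ltW lz0).
have w0 := lambertW_gt0 lz0.
have dlz : is_derive z 1 (fun z => l * z) l.
  by apply: is_derive_eq (is_deriveZ l (is_derive_id z 1)) _; rewrite [LHS]mulr1.
have dW := is_derive1_comp (is_derive_lambertW lz0) dlz.
set w := lambertW (l * z) in wE w0 dW *.
have e0 := expR_gt0 w.
have lE : l = w * expR w / z by rewrite -/(wexp w) wE; field; exact: lt0r_neq0.
have w1 : 1 + w != 0 by rewrite gt_eqF// addr_gt0.
split; rewrite -/w.
- by rewrite !mulr_ge0// ?expR_ge0 ?ltW.
- have w10 : 0 < 1 + w by rewrite addr_gt0.
  by rewrite divr_ge0 ?(ltW w0) ?(ltW w10)//= ler_pdivrMr// mul1r lerDr.
- apply: is_derive_eq (is_deriveZ k (is_deriveD dW (is_deriveZ 2^-1 (is_deriveX 2 dW)))) _.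
  rewrite /GRing.scale/= -/w expRN.
  by field; rewrite w1 gt_eqF.
- have D := @is_derive1_comp _ expR _ _ _ _ (is_derive_expR _) (is_deriveN dW).
  apply: is_derive_eq (is_deriveZ (k * l) D) _.
  rewrite /GRing.scale/= -/w expRN lE.
  by field; rewrite w1 !gt_eqF.
Qed.

End profiles.

(** * Gradient and Hessian of the semi-dual objective *)

Section atomic_source.
Variables (R : realType) (X Y : ptopologicalType) (n m : nat).
Variables (c : X * Y -> R) (beta : 'I_n -> R) (y : 'I_n -> Y).
Variables (eps rho2 : R) (a : 'I_m -> R) (x : 'I_m -> X).
Variables (phi psi th : R -> R).
Hypothesis n_gt0 : (0 < n)%N.
Hypothesis beta_gt0 : forall j, 0 < beta j.
Hypothesis eps_gt0 : 0 < eps.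
Hypothesis rho2_gt0 : 0 < rho2.
Hypothesis a_ge0 : forall i, 0 <= a i.
Hypothesis profile : tame_profile phi psi th.
Implicit Types (g u v w : 'rV[R]_n) (s t : R).

Local Notation B := (ot_B c beta y eps).
Local Notation Z := (ot_Z c beta y eps).

Lemma ot_B_gt0 p g j : 0 < B p g j.
Proof. by rewrite mulr_gt0 ?expR_gt0. Qed.

Lemma ot_Z_gt0 p g : 0 < Z p g.
Proof.
rewrite /ot_Z; case: n n_gt0 beta y g beta_gt0 => // k _ be yy g be0.
rewrite big_ord_recl ltr_pwDl ?mulr_gt0 ?expR_gt0// sumr_ge0// => j _.
by rewrite mulr_ge0 ?expR_ge0 ?(ltW (be0 _)).
Qed.

Lemma is_derive_ot_B p g v j s :
  is_derive s 1 (fun s => B p (g + s *: v) j) (B p (g + s *: v) j * v 0 j / eps).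
Proof.
have D : is_derive s 1 (fun s : R => eps^-1 * (g 0 j - c (p, y j)) + (v 0 j / eps) * s)
    (v 0 j / eps).
  apply: is_derive_eq (is_deriveD (is_derive_cst _ s 1)
    (is_deriveZ (v 0 j / eps) (is_derive_id s 1))) _.
  by rewrite add0r [LHS]mulr1.
have E t : B p (g + t *: v) j =
    beta j * expR (eps^-1 * (g 0 j - c (p, y j)) + (v 0 j / eps) * t).
  by rewrite /ot_B !mxE; congr (_ * expR _); field; exact: lt0r_neq0.
rewrite (funext E) E.
apply: is_derive_eq (is_deriveZ (beta j) (is_derive1_comp (is_derive_expR _) D)) _.
by rewrite /GRing.scale/=; ring.
Qed.

Lemma is_derive_ot_Z p g v s :
  is_derive s 1 (fun s => Z p (g + s *: v))
    (lin_form (B p (g + s *: v)) v / eps).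
Proof.
rewrite /lin_form mulr_suml; apply: is_derive_bigsum => j.
exact: is_derive_ot_B.
Qed.

Definition trans g : R := \sum_(i < m) a i * phi (Z (x i) g).

Definition trans_grad g : 'rV[R]_n :=
  \row_j \sum_(i < m) a i * psi (Z (x i) g) * B (x i) g j / eps.

Definition penalty g : R :=
  \sum_(j < n) beta j * (g 0 j ^+ 2 / (2 * rho2) - g 0 j).

Definition semidual_grad g : 'rV[R]_n :=
  trans_grad g + \row_j (beta j * (g 0 j / rho2 - 1)).

Lemma lin_form_delta (d : 'I_n -> R) j : lin_form d (delta_mx 0 j) = d j.
Proof.
rewrite /lin_form (bigD1 j)//= mxE !eqxx mulr1 big1 ?addr0// => k kj.
by rewrite mxE (negbTE kj) andbF mulr0.
Qed.

Lemma is_derive_trans g v s : is_derive s 1 (fun s => trans (g + s *: v))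
  (\sum_(i < m) a i * psi (Z (x i) (g + s *: v)) *
     lin_form (B (x i) (g + s *: v)) v / eps).
Proof.
apply: is_derive_bigsum => i.
have [_ _ D _] := profile (ot_Z_gt0 (x i) (g + s *: v)).
apply: is_derive_eq (is_deriveZ (a i) (is_derive1_comp D (is_derive_ot_Z _ _ _ _))) _.
by rewrite /GRing.scale/= !mulrA.
Qed.

Lemma is_derive_penalty g v s : is_derive s 1 (fun s => penalty (g + s *: v))
  (\sum_(j < n) beta j * ((g + s *: v) 0 j / rho2 - 1) * v 0 j).
Proof.
apply: is_derive_bigsum => j.
have D : is_derive s 1 (fun s => (g + s *: v) 0 j) (v 0 j).
  have E t : (g + t *: v) 0 j = g 0 j + v 0 j * t by rewrite !mxE mulrC.
  rewrite (funext E).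
  apply: is_derive_eq (is_deriveD (is_derive_cst _ s 1)
    (is_deriveZ (v 0 j) (is_derive_id s 1))) _.
  by rewrite add0r [LHS]mulr1.
have E t : beta j * ((g + t *: v) 0 j ^+ 2 / (2 * rho2) - (g + t *: v) 0 j) =
    beta j * ((2 * rho2)^-1 * (g + t *: v) 0 j ^+ 2 - (g + t *: v) 0 j).
  by rewrite [_ / (2 * rho2)]mulrC.
rewrite (funext E).
apply: is_derive_eq (is_deriveZ (beta j)
  (is_deriveB (is_deriveZ (2 * rho2)^-1 (is_deriveX 2 D)) D)) _.
by rewrite /GRing.scale/=; field; exact: lt0r_neq0.
Qed.

Lemma gradient_trans g : gradient trans g = trans_grad g.
Proof.
apply/rowP => j; rewrite !mxE; apply: derive_line.
apply: is_derive_eq (is_derive_trans _ _ _) _; rewrite scale0r addr0.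
by apply: eq_bigr => i _; rewrite lin_form_delta.
Qed.

Lemma gradient_semidual g :
  gradient (fun g => trans g + penalty g) g = semidual_grad g.
Proof.
apply/rowP => j; rewrite !mxE; apply: derive_line.
apply: is_derive_eq (is_deriveD (is_derive_trans _ _ _) (is_derive_penalty _ _ _)) _.
rewrite scale0r addr0; congr (_ + _).
  by apply: eq_bigr => i _; rewrite lin_form_delta.
exact: (lin_form_delta (fun k => beta k * (g 0 k / rho2 - 1))).
Qed.

(** The second derivative of the objective at [g], as a bilinear form; keeping
    it in this form avoids matrices altogether. *)
Definition hess g u v : R :=
  \sum_(i < m) a i * psi (Z (x i) g) / eps ^+ 2 *
    (diag_form (B (x i) g) u v
     - th (Z (x i) g) / Z (x i) g *
       (lin_form (B (x i) g) u * lin_form (B (x i) g) v))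
  + diag_form (fun j => beta j / rho2) u v.

Lemma is_derive_semidual_grad_coord g v j s :
  is_derive s 1 (fun s => semidual_grad (g + s *: v) 0 j)
    (\sum_(i < m) a i * psi (Z (x i) (g + s *: v)) / eps ^+ 2 *
       (B (x i) (g + s *: v) j * v 0 j
        - th (Z (x i) (g + s *: v)) / Z (x i) (g + s *: v) *
          (B (x i) (g + s *: v) j * lin_form (B (x i) (g + s *: v)) v))
     + beta j / rho2 * v 0 j).
Proof.
have E t : semidual_grad (g + t *: v) 0 j =
    \sum_(i < m) a i / eps * (psi (Z (x i) (g + t *: v)) * B (x i) (g + t *: v) j)
    + (beta j * (g 0 j / rho2 - 1) + beta j * v 0 j / rho2 * t).
  rewrite !mxE; congr (_ + _); last by ring.
  by apply: eq_bigr => i _; ring.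
rewrite (funext E); apply: is_deriveD.
  apply: is_derive_bigsum => i.
  have Z0 := ot_Z_gt0 (x i) (g + s *: v).
  have [_ _ _ D] := profile Z0.
  apply: is_derive_eq (is_deriveZ (a i / eps)
    (is_deriveM (is_derive1_comp D (is_derive_ot_Z _ _ _ _))
      (is_derive_ot_B _ _ _ _ _))) _.
  by rewrite /GRing.scale/=; field; rewrite !gt_eqF.
apply: is_derive_eq (is_deriveD (is_derive_cst _ s 1)
    (is_deriveZ (beta j * v 0 j / rho2) (is_derive_id s 1))) _.
by rewrite add0r [LHS]mulr1; ring.
Qed.

Lemma is_derive_semidual_grad g u v s :
  is_derive s 1 (fun s => lin_form (fun j => semidual_grad (g + s *: v) 0 j) u)
    (hess (g + s *: v) u v).
Proof.
have D : is_derive s 1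
    (fun s => \sum_(j < n) u 0 j * semidual_grad (g + s *: v) 0 j) _ :=
  is_derive_bigsum (fun j => is_deriveZ (u 0 j) (is_derive_semidual_grad_coord g v j s)).
rewrite (_ : (fun s => _) =
  (fun s => \sum_(j < n) u 0 j * semidual_grad (g + s *: v) 0 j)); last first.
  by apply/funext => t; apply: eq_bigr => j _; rewrite mulrC.
apply: is_derive_eq D _.
rewrite /GRing.scale/= /hess; under eq_bigr do rewrite mulrDr mulr_sumr.
rewrite big_split exchange_big /=; congr (_ + _); apply: eq_bigr => i _; last by ring.
rewrite (eq_bigr (fun j => a i * psi (Z (x i) (g + s *: v)) / eps ^+ 2 *
  (B (x i) (g + s *: v) j * (u 0 j * v 0 j)
    - th (Z (x i) (g + s *: v)) / Z (x i) (g + s *: v) *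
      (B (x i) (g + s *: v) j * u 0 j * lin_form (B (x i) (g + s *: v)) v))));
  last by move=> j _; ring.
by rewrite -mulr_sumr sumrB -mulr_sumr -mulr_suml.
Qed.

Lemma hess_line g u v t :
  hess g (u + t *: v) (u + t *: v) =
  hess g u u + 2 * t * hess g u v + t ^+ 2 * hess g v v.
Proof.
rewrite /hess diag_form_line; set S := (X in X + _ = _).
set S1 := (X in X + _ + _ + _); set S2 := (X in _ + 2 * t * (X + _)).
set S3 := (X in _ + t ^+ 2 * (X + _)).
suff -> : S = S1 + 2 * t * S2 + t ^+ 2 * S3 by ring.
rewrite !mulr_sumr -!big_split /=; apply: eq_bigr => i _.
by rewrite diag_form_line !lin_form_line; ring.
Qed.

(** Each atom contributes at least [0] because [th <= 1] and, by
    Cauchy-Schwarz, the square of the linear form is at most [Z] times the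
    diagonal form. It contributes at most its diagonal form because [th >= 0];
    the diagonal forms add up to the transport gradient divided by [eps]. *)
Lemma hess_bounds g M w : (forall j, trans_grad g 0 j / eps + beta j / rho2 <= M) ->
  0 <= hess g w w <= M * enorm w ^+ 2.
Proof.
move=> dM.
have atom i : 0 <= diag_form (B (x i) g) w w
     - th (Z (x i) g) / Z (x i) g * (lin_form (B (x i) g) w * lin_form (B (x i) g) w)
     <= diag_form (B (x i) g) w w.
  have Z0 := ot_Z_gt0 (x i) g.
  have [_ /andP[th0 th1] _ _] := profile Z0.
  have := @lin_form_sqr_le _ _ (B (x i) g) w Z0 (fun j => ltW (ot_B_gt0 _ _ _)).
  rewrite -/(Z (x i) g) mulrC -ler_pdivrMr// => CS.
  rewrite -expr2 gerBl mulr_ge0 ?sqr_ge0 ?divr_ge0 ?(ltW Z0)// andbT subr_ge0.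
  apply: le_trans CS; rewrite mulrAC -mulrA ler_piMl//.
  by rewrite divr_ge0 ?sqr_ge0 ?ltW.
have coef0 i : 0 <= a i * psi (Z (x i) g) / eps ^+ 2.
  have [psi0 _ _ _] := profile (ot_Z_gt0 (x i) g).
  by rewrite divr_ge0 ?sqr_ge0 ?mulr_ge0 ?a_ge0.
apply/andP; split.
  rewrite addr_ge0//.
    by apply: sumr_ge0 => i _; rewrite mulr_ge0//; have /andP[] := atom i.
  by apply: diag_form_ge0 => j; rewrite divr_ge0 ?ltW.
apply: le_trans (diag_form_le w dM).
rewrite (_ : diag_form _ w w = \sum_(i < m) a i * psi (Z (x i) g) / eps ^+ 2 *
    diag_form (B (x i) g) w w + diag_form (fun j => beta j / rho2) w w).
  rewrite lerD2r; apply: ler_sum => i _.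
  by rewrite ler_wpM2l//; have /andP[] := atom i.
rewrite /diag_form; under eq_bigr do rewrite mulrDl !mxE !mulr_suml.
rewrite big_split exchange_big /=; congr (_ + _); apply: eq_bigr => i _.
by rewrite mulr_sumr; apply: eq_bigr => j _; field; exact: lt0r_neq0.
Qed.

(** One factor [exp t] comes from [B_j], the other one from [psi (Z)], through
    [Z >= exp (- t) * Z0]. *)
Lemma trans_grad_harnack g0 g t : 0 <= t ->
  (forall j, `|g 0 j - g0 0 j| <= t * eps) ->
  forall j, 0 <= trans_grad g 0 j <= expR (2 * t) * trans_grad g0 0 j.
Proof.
move=> t0 close j.
have Bexp i k : B (x i) g k = B (x i) g0 k * expR ((g 0 k - g0 0 k) / eps).
  by rewrite /ot_B -mulrA -expRD; congr (_ * expR _); field; exact: lt0r_neq0.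
have close' k : - t <= (g 0 k - g0 0 k) / eps <= t.
  rewrite ler_pdivlMr// ler_pdivrMr// mulNr -ler_norml; exact: close.
have ZlZ i : expR (- t) * Z (x i) g0 <= Z (x i) g.
  rewrite mulr_sumr; apply: ler_sum => k _; rewrite Bexp mulrC.
  rewrite ler_wpM2l ?(ltW (ot_B_gt0 _ _ _))// ler_expR.
  by have /andP[] := close' k.
have psi0 i gg : 0 <= psi (Z (x i) gg) by have [] := profile (ot_Z_gt0 (x i) gg).
rewrite !mxE; apply/andP; split.
  apply: sumr_ge0 => i _.
  have B0 := ltW (ot_B_gt0 (x i) g j).
  exact: divr_ge0 (mulr_ge0 (mulr_ge0 (a_ge0 i) (psi0 i g)) B0) (ltW eps_gt0).
rewrite mulr_sumr; apply: ler_sum => i _.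
have psi_le : psi (Z (x i) g) <= expR t * psi (Z (x i) g0).
  exact: (profile_harnack profile t0 (ot_Z_gt0 _ _) (ZlZ i)).
have B_le : B (x i) g j <= expR t * B (x i) g0 j.
  rewrite Bexp mulrC ler_wpM2r ?(ltW (ot_B_gt0 _ _ _))// ler_expR.
  by have /andP[] := close' j.
have := ler_pM (psi0 i g) (ltW (ot_B_gt0 _ _ _)) psi_le B_le.
move=> /(ler_wpM2l (divr_ge0 (a_ge0 i) (ltW eps_gt0))); rewrite mulr2n mulrDl mul1r expRD.
by congr (_ <= _); field; exact: lt0r_neq0.
Qed.


(** With [u] the difference of the gradients and [v] that of the points, the
    mean value theorem applied to the pairing of the gradient with [u] gives
    [enorm u ^+ 2 = hess u v] at some point of the segment, and [form_le]
    concludes. *)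
Lemma semidual_grad_lipschitz g1 g2 M : 0 < M ->
  (forall s, 0 <= s <= 1 -> forall j,
     trans_grad (g2 + s *: (g1 - g2)) 0 j / eps + beta j / rho2 <= M) ->
  enorm (semidual_grad g1 - semidual_grad g2) <= M * enorm (g1 - g2).
Proof.
move=> M0 dM; set u := semidual_grad g1 - semidual_grad g2; set v := g1 - g2.
pose h s := lin_form (fun j => semidual_grad (g2 + s *: v) 0 j) u.
have [||s s01] := @MVT_segment _ h (fun s => hess (g2 + s *: v) u v) 0 1 ler01.
- by move=> s _; exact: is_derive_semidual_grad.
- apply: continuous_subspaceT => s; have [D _] := is_derive_semidual_grad g2 u v s.
  exact/differentiable_continuous/derivable1_diffP.
rewrite /h scale1r scale0r addr0 subr0 mulr1 [g2 + v]addrC subrK => hE.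
have uE : enorm u ^+ 2 = hess (g2 + s *: v) u v.
  rewrite -hE /enorm sqr_sqrtr ?sumr_ge0// => [|j _]; last exact: sqr_ge0.
  rewrite -sumrB; apply: eq_bigr => j _.
  by rewrite expr2 {1}/u !mxE; ring.
have := @form_le _ _ (hess (g2 + s *: v)) M u v M0 (hess_line _ u v).
rewrite -uE => /(_ (fun w => hess_bounds w (dM s s01))) uv.
rewrite -(@ler_pXn2r _ 2)// ?nnegrE ?mulr_ge0 ?sqrtr_ge0 ?(ltW M0)//.
by rewrite exprMn; lra.
Qed.

End atomic_source.

(** * Smoothness along the descent segment *)

Section descent_segment.
Variables (R : realType) (X Y : ptopologicalType) (n m : nat).
Variables (c : X * Y -> R) (beta : 'I_n -> R) (y : 'I_n -> Y).
Variables (eps rho2 : R) (a : 'I_m -> R) (x : 'I_m -> X).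
Variables (phi psi th : R -> R).
Hypothesis n_gt0 : (0 < n)%N.
Hypothesis beta_gt0 : forall j, 0 < beta j.
Hypothesis eps_gt0 : 0 < eps.
Hypothesis rho2_gt0 : 0 < rho2.
Hypothesis a_ge0 : forall i, 0 <= a i.
Hypothesis profile : tame_profile phi psi th.

Local Notation tgrad := (trans_grad c beta y eps a x psi).
Local Notation sgrad := (semidual_grad c beta y eps rho2 a x psi).

Lemma beta_le_max j : beta j <= beta_max beta.
Proof. exact: (le_bigmax 0 beta j). Qed.

Lemma beta_max_gt0 : 0 < beta_max beta.
Proof. exact: lt_le_trans (beta_gt0 (Ordinal n_gt0)) (beta_le_max _). Qed.

(** Of the three terms of [L], the last one bounds the displacement, through the
    step [1 / L]; the other two dominate the Hessian after that displacement. *)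
Lemma segment_lipschitz (C L : R) (gt : 'rV[R]_n) (s1 s2 : R) :
  2 * expR 1 <= C -> 0 <= s1 <= 1 -> 0 <= s2 <= 1 ->
  L = C / eps * `|tgrad gt| + C * beta_max beta / rho2
      + C / (expR 1 * eps) * `|sgrad gt| ->
  enorm (sgrad (gt - (s1 * (1 / L)) *: sgrad gt)
         - sgrad (gt - (s2 * (1 / L)) *: sgrad gt))
    <= L * enorm (gt - (s1 * (1 / L)) *: sgrad gt
                  - (gt - (s2 * (1 / L)) *: sgrad gt)).
Proof.
move=> Ce s1P s2P LE; pose g s := gt - (s * (1 / L)) *: sgrad gt.
rewrite -/(g s1) -/(g s2).
have e0 : 0 < expR 1 :> R := expR_gt0 1.
have e1 : 1 <= expR 1 :> R by rewrite -expR0 ler_expR.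
have C0 : 0 < C by apply: lt_le_trans Ce; rewrite mulr_gt0.
have L2 : 0 < C * beta_max beta / rho2 by rewrite divr_gt0 ?mulr_gt0 ?beta_max_gt0.
have L1 : 0 <= C / eps * `|tgrad gt| by rewrite mulr_ge0// divr_ge0 ?ltW.
have ee0 : 0 < expR 1 * eps by rewrite mulr_gt0.
have L3 : 0 <= C / (expR 1 * eps) * `|sgrad gt| by rewrite mulr_ge0// divr_ge0 ?ltW.
have L0 : 0 < L by rewrite LE; lra.
apply: (semidual_grad_lipschitz n_gt0 beta_gt0 eps_gt0 rho2_gt0 a_ge0 profile) => //.
move=> s /andP[s0 sle1] j.
have -> : g s2 + s *: (g s1 - g s2) = g (s2 + s * (s1 - s2)).
  by apply/rowP => k; rewrite !mxE; ring.
set r := s2 + _.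
have r01 : 0 <= r <= 1.
  by case/andP: s1P => ? ?; case/andP: s2P => ? ?; apply/andP; split; rewrite /r; nra.
have close k : `|g r 0 k - gt 0 k| <= 2^-1 * eps.
  have -> : g r 0 k - gt 0 k = - (r * (1 / L) * sgrad gt 0 k).
    by rewrite /g; move: (sgrad gt) => v; rewrite !mxE; ring.
  rewrite normrN !normrM.
  case/andP: r01 => r0 r1; rewrite (ger0_norm r0) normr1 mul1r (@gtr0_norm _ L^-1) ?invr_gt0//.
  (* the gradient term of L alone gives |sgrad| / L <= e * eps / C <= eps / 2 *)
  have step : `|sgrad gt| / L <= 2^-1 * eps.
    rewrite ler_pdivrMr//.
    have : C / (expR 1 * eps) * `|sgrad gt| <= L by rewrite LE; lra.
    have : 2 / eps * `|sgrad gt| <= C / (expR 1 * eps) * `|sgrad gt|.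
      rewrite ler_wpM2r// ler_pdivrMr//.
      rewrite (_ : C / _ * eps = C / expR 1) ?ler_pdivlMr//.
      by field; rewrite !gt_eqF.
    move=> /le_trans/[apply] /(ler_wpM2l (ltW eps_gt0)).
    rewrite (_ : eps * (2 / eps * _) = 2 * `|sgrad gt|); last by field; rewrite gt_eqF.
    lra.
  apply: le_trans step; rewrite [leRHS]mulrC.
  have V0 : 0 <= L^-1 by rewrite invr_ge0 ltW.
  by apply: ler_pM; rewrite ?mulr_ge0 ?ler_piMl ?coord_le_norm.
have half0 : 0 <= 2^-1 :> R by rewrite invr_ge0.
have /andP[_] := trans_grad_harnack c y x n_gt0 beta_gt0 eps_gt0 a_ge0 profile half0 close j.
rewrite divff ?pnatr_eq0// => tj.
have tgt : trans_grad c beta y eps a x psi gt 0 j <= `|tgrad gt|.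
  exact: le_trans (ler_norm _) (coord_le_norm _ _).
have T1 : tgrad (g r) 0 j / eps <= C / eps * `|tgrad gt|.
  rewrite mulrAC ler_wpM2r ?invr_ge0 ?(ltW eps_gt0)// (le_trans tj)//.
  rewrite (le_trans (ler_wpM2l (ltW e0) tgt))// ler_wpM2r//; lra.
have T2 : beta j / rho2 <= C * beta_max beta / rho2.
  rewrite ler_wpM2r ?invr_ge0 ?(ltW rho2_gt0)// (le_trans (beta_le_max j))//.
  by rewrite ler_peMl ?(ltW beta_max_gt0)//; lra.
by rewrite LE; lra.
Qed.

End descent_segment.

(** * Integration against a discrete measure *)

Section discrete_integral.
Variables (R : realType) (T : ptopologicalType).

Lemma continuous_borel_measurable (f : T -> R) :
  continuous f -> measurable_fun [set: borel T] (f : borel T -> R).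
Proof.
move=> /continuousP cf; apply: (measurability _ (RGenOpens.measurableE R)).
move=> _ [_ [a [b ->]] <-]; rewrite setTI; apply: sub_sigma_algebra.
exact/cf/interval_open.
Qed.

Lemma Rintegral_discrete n (mu : {measure set (borel T) -> \bar R})
    (w : 'I_n -> R) (p : 'I_n -> T) (f : T -> R) :
  (forall i, 0 <= w i) -> is_discrete_measure mu w p ->
  continuous f -> (forall t, 0 <= f t) ->
  \int[mu]_t f t = \sum_(i < n) w i * f (p i).
Proof.
move=> w0 muE cf f0; have mf := continuous_borel_measurable cf.
(* msum takes a sequence of measures: indices beyond n are filled with mzero *)
pose m_ k : {measure set (borel T) -> \bar R} :=
  if insub k is Some i then mscale (NngNum (w0 i)) (dirac (p i : borel T)) else mzero.
have muE' A : measurable A -> A `<=` setT -> mu A = msum m_ n A.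
  move=> mA _; rewrite muE// /msum; apply: eq_bigr => i _.
  by rewrite /m_ valK.
rewrite /Rintegral (eq_measure_integral _ muE') ge0_integral_measure_sum//=.
- rewrite (eq_bigr (fun i => (w i * f (p i))%:E)) ?sumEFin//= => i _.
  rewrite /m_ valK ge0_integral_mscale//=.
  + rewrite integral_dirac//.
      by rewrite diracT mul1e.
    exact/measurable_EFinP.
  + exact/measurable_EFinP.
  + by move=> t _; rewrite lee_fin.
- by move=> t _; rewrite lee_fin.
- exact/measurable_EFinP.
Qed.

End discrete_integral.

Section source_of_discrete_measure.
Variables (R : realType) (X Y : ptopologicalType) (n m : nat).
Variables (c : X * Y -> R) (beta : 'I_n -> R) (y : 'I_n -> Y) (eps : R).
Hypothesis c_cont : continuous c.

Lemma continuous_ot_Z g : continuous (fun p => ot_Z c beta y eps p g).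
Proof.
have cj j : continuous (fun p => c (p, y j)).
  move=> p; apply: (@continuous_comp _ _ _ (fun p => (p, y j)) c); last exact: c_cont.
  by apply: cvg_pair; [exact: cvg_id|exact: cvg_cst].
have Bj j : continuous (fun p => ot_B c beta y eps p g j).
  move=> p; apply: cvgM; first exact: cvg_cst.
  apply: (@continuous_comp _ _ _ (fun p => (g 0 j - c (p, y j)) / eps) expR);
    last exact: continuous_expR.
  apply: cvgM; last exact: cvg_cst.
  by apply: cvgB; [exact: cvg_cst|exact: cj].
by apply: continuous_big => //; exact: add_continuous.
Qed.

(** The constant [k] is part of the profile, while the objective has it outside
    the integral. Derivability of the profile makes the integrand continuous, hence
    Borel measurable, so that its integral is a sum over the atoms. *)
Lemma integral_trans (mu : {measure set (borel X) -> \bar R})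
    (a : 'I_m -> R) (x : 'I_m -> X) (k : R) (phi psi th : R -> R) g :
  (0 < n)%N -> (forall j, 0 < beta j) ->
  (forall i, 0 <= a i) -> is_discrete_measure mu a x -> 0 < k ->
  (forall z, 0 < z -> 0 <= phi z) -> tame_profile (fun z => k * phi z) psi th ->
  k * \int[mu]_p phi (ot_Z c beta y eps p g) =
  trans c beta y eps a x (fun z => k * phi z) g.
Proof.
move=> n0 b0 a0 muE k0 phi0 H; rewrite (Rintegral_discrete a0 muE); last 1 first.
- by move=> p; apply/phi0/ot_Z_gt0.
-  by rewrite mulr_sumr; apply: eq_bigr => i _; rewrite mulrCA.
move=> p; have Z0 := ot_Z_gt0 c y eps n0 b0 p g.
have E : phi = (fun z => k^-1 * (k * phi z)).
  by apply/funext => z; rewrite mulKf// gt_eqF.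
apply: (@continuous_comp _ _ _ (fun p => ot_Z c beta y eps p g) phi).
  exact: continuous_ot_Z.
have [_ _ D _] := H _ Z0.
have [D' _] := is_deriveZ k^-1 D.
by rewrite E; apply/differentiable_continuous/derivable1_diffP.
Qed.

End source_of_discrete_measure.

(** * The two sources *)

Unset Implicit Arguments.

Theorem proposition11 (R : realType) (X Y : ptopologicalType)
  (polishX : polish_space R X) (polishY : polish_space R Y)
  (n1 n2 : nat) (n2_gt0 : (0 < n2)%N)
  (alpha : 'I_n1 -> R) (x : 'I_n1 -> X) (beta : 'I_n2 -> R) (y : 'I_n2 -> Y)
  (mu : {measure set (borel X) -> \bar R})
  (nu : {measure set (borel Y) -> \bar R})
  (alpha_ge0 : forall i, 0 <= alpha i)
  (mu_discrete : is_discrete_measure mu alpha x)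
  (nu_discrete : is_discrete_measure nu beta y)
  (b B : R) (b_gt0 : 0 < b) (b_le_B : b <= B)
  (beta_bounds : forall j, b / n2%:R <= beta j <= B / n2%:R)
  (c : X * Y -> R) (c_ge0 : forall p, 0 <= c p) (c_cont : continuous c)
  (eps rho1 rho2 : R)
  (eps_gt0 : 0 < eps) (rho1_gt0 : 0 < rho1) (rho2_gt0 : 0 < rho2)
  (src : source) (gt g1 g2 : 'rV[R]_n2)
  (g1_seg : grad_segment src mu c beta y eps rho1 rho2 gt g1)
  (g2_seg : grad_segment src mu c beta y eps rho1 rho2 gt g2) :
  let J := J_semidual src mu c beta y eps rho1 rho2 in
  enorm (gradient J g1 - gradient J g2)
    <= smooth_L src mu c beta y eps rho1 rho2 gt * enorm (g1 - g2).
Proof.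
have beta_gt0 j : 0 < beta j.
  have /andP[bj _] := beta_bounds j.
  by apply: lt_le_trans bj; rewrite divr_gt0// ltr0n.
have sum_gt0 : 0 < eps + rho1 by rewrite addr_gt0.
have al01 : 0 <= ot_alpha eps rho1 <= 1.
  rewrite /ot_alpha divr_ge0 ?(ltW eps_gt0) ?(ltW sum_gt0)//=.
  by rewrite ler_pdivrMr// mul1r lerDl ltW.
have [phi [psi [th [profile JE]]]] : exists phi psi th, tame_profile phi psi th /\
    J_trans src mu c beta y eps rho1 = trans c beta y eps alpha x phi.
  case: src {g1_seg g2_seg}.
    exists (fun z => (rho1 + eps) * z `^ ot_alpha eps rho1).
    do 2 eexists; split; first by apply: powR_profile => //; rewrite addr_ge0 ?ltW.
    apply/funext => g; rewrite /J_trans.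
    apply: integral_trans => //; first by rewrite addr_gt0.
    - by move=> z _; exact: powR_ge0.
    - by apply: powR_profile => //; rewrite addr_ge0 ?ltW.
  have k_gt0 : 0 < eps ^+ 2 / rho1 by rewrite divr_gt0 ?exprn_gt0.
  have l_gt0 : 0 < rho1 / eps * expR (rho1 / eps) by rewrite mulr_gt0 ?expR_gt0 ?divr_gt0.
  do 3 eexists; split; first exact: lambertW_profile (ltW k_gt0) l_gt0.
  apply/funext => g; rewrite /J_trans /ot_U.
  apply: (@integral_trans _ _ _ _ _ c beta y eps c_cont mu alpha x (eps ^+ 2 / rho1)
    (fun z => lambertW (rho1 / eps * expR (rho1 / eps) * z) +
      2^-1 * lambertW (rho1 / eps * expR (rho1 / eps) * z) ^+ 2)) => //.
  - move=> z z0; have lz0 := lambertW_gt0 (mulr_gt0 l_gt0 z0).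
    by rewrite addr_ge0 ?mulr_ge0 ?invr_ge0 ?sqr_ge0 ?ltW.
  - exact: lambertW_profile (ltW k_gt0) l_gt0.
have tgradE g : gradient (J_trans src mu c beta y eps rho1) g =
    trans_grad c beta y eps alpha x psi g.
  by rewrite JE; exact: (gradient_trans c y alpha x n2_gt0 beta_gt0 eps_gt0 profile).
have sgradE g : gradient (J_semidual src mu c beta y eps rho1 rho2) g =
    semidual_grad c beta y eps rho2 alpha x psi g.
  rewrite /J_semidual JE.
  exact: (gradient_semidual c y alpha x n2_gt0 beta_gt0 eps_gt0 rho2_gt0 profile).
have Ce : 2 * expR 1 <= smooth_const src eps rho1.
  rewrite /smooth_const; have e0 : 0 < expR 1 :> R := expR_gt0 1.
  by case: src {g1_seg g2_seg JE tgradE sgradE}; rewrite ler_pM2r//; case/andP: al01; lra.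
case: g1_seg => s1 /= + <-; rewrite in_itv/= => s1P.
case: g2_seg => s2 /= + <-; rewrite in_itv/= => s2P.
cbv zeta; rewrite /grad_step /step_size !sgradE.
apply: (segment_lipschitz n2_gt0 beta_gt0 eps_gt0 rho2_gt0 alpha_ge0 profile Ce) => //.
by rewrite /smooth_L tgradE sgradE.
Qed.
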